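(* Let $G$ be an abelian group with identity $e$ and $g\in G$. For $i=1,2$ let $R_i$ be a $G$-graded $gr$-Noetherian ring, $M_i$ a graded $R_i$-module and $N_i=\oplus_{h\in G}N_{i,h}$ a graded submodule of $M_i$. Let $R=R_1\times R_2$ and $M=M_1\times M_2$ be such that $M_g$ is a fully $g$-idempotent $R_e$-module, and let $N=N_1\times N_2$. Then the following statements are equivalent: (i) $N_g$ is a $g$-$G2$-absorbing submodule of $M_g$. (ii) Either $N_{1,g}=M_{1,g}$ and $N_{2,g}$ is a $g$-$G2$-absorbing submodule of $M_{2,g}$; or $N_{2,g}=M_{2,g}$ and $N_{1,g}$ is a $g$-$G2$-absorbing submodule of $M_{1,g}$; or $N_{1,g}$ and $N_{2,g}$ are $g$-primary submodules of $M_{1,g}$ and $M_{2,g}$, respectively.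
   Context: All rings are commutative with identity and all modules are unitary. $G$ is an abelian multiplicative group with identity $e$. A $G$-graded ring is $R=\oplus_{g\in G}R_g$ with $R_gR_h\subseteq R_{gh}$; $R_e$ is a subring containing $1$. $R$ is $gr$-Noetherian if it satisfies the ascending chain condition on graded ideals. A graded $R$-module is $M=\oplus_{g\in G}M_g$ with $R_gM_h\subseteq M_{gh}$; each $M_g$ is an $R_e$-module. A submodule $N$ of $M$ is graded if $N=\oplus_g N_g$ with $N_g=N\cap M_g$. The degree-$h$ components of $R_i$, $M_i$, $N_i$ are written $R_{i,h}$, $M_{i,h}$, $N_{i,h}$. The product $R=R_1\times R_2$ is graded by $R_h=R_{1,h}\times R_{2,h}$, and $M=M_1\times M_2$ is the graded $R$-module (componentwise action) with $M_h=M_{1,h}\times M_{2,h}$; thus $N_g=N_{1,g}\times N_{2,g}$. $M_{i,g}$ is regarded as an $R_{i,e}$-module and $M_g$ as an $R_e$-module. The following are for a graded module $M$ over a graded ring $R$ and an $R_e$-submodule $L$ of $M_g$; $(L:_{R_e}X)=\{r\in R_e: rX\subseteq L\}$. $L$ is $g$-idempotent if $L=(L:_{R_e}M_g)^2M_g$; $M_g$ is fully $g$-idempotent if every $R_e$-submodule of $M_g$ is $g$-idempotent. $L$ is $g$-$G2$-absorbing if $L\neq M_g$ and whenever $r,s\in R_e$, $m\in M_g$ with $rsm\in L$, then $r^{k_1}m\in L$ for some $k_1\in\mathbb{Z}^+$, or $s^{k_2}m\in L$ for some $k_2\in\mathbb{Z}^+$, or $rs\in(L:_{R_e}M_g)$.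 $L$ is $g$-primary if $L\neq M_g$ and whenever $r\in R_e$, $m\in M_g$ with $rm\in L$, then $m\in L$ or $r^n\in(L:_{R_e}M_g)$ for some $n\geq1$. *)

(* Defs.v *)
From HB Require Import structures.
From mathcomp Require Import all_boot all_algebra.
From mathcomp Require Import boolp classical_sets.

Set Implicit Arguments.
Unset Strict Implicit.
Unset Printing Implicit Defensive.

Import GRing.Theory.

Local Open Scope classical_set_scope.
Local Open Scope ring_scope.

(* MathComp only equips M1 * M2 with a module structure when both factors are
   modules over the same ring; [prodmod M1 M2] is M1 * M2 seen as an
   R1 * R2-module, with the componentwise action. *)
Definition prodmod (R1 R2 : comPzRingType) (M1 : lmodType R1)
  (M2 : lmodType R2) : Type := (M1 * M2)%type.

Section ProdMod.
Variables (R1 R2 : comPzRingType) (M1 : lmodType R1) (M2 : lmodType R2).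

HB.instance Definition _ := GRing.Zmodule.copy (prodmod M1 M2) (M1 * M2)%type.

Definition prodmod_scale (r : R1 * R2) (m : prodmod M1 M2) : prodmod M1 M2 :=
  (r.1 *: m.1, r.2 *: m.2).

Fact prodmod_scaleA r s m :
  prodmod_scale r (prodmod_scale s m) = prodmod_scale (r * s) m.
Proof. by congr (_, _); apply: scalerA. Qed.

Fact prodmod_scale1 : left_id 1 prodmod_scale.
Proof. by case=> m1 m2; rewrite /prodmod_scale /= !scale1r. Qed.

Fact prodmod_scaleDr : right_distributive prodmod_scale +%R.
Proof. by move=> r m n; congr (_, _); apply: scalerDr. Qed.

Fact prodmod_scaleDl m : {morph prodmod_scale^~ m : r s / r + s}.
Proof. by move=> r s; congr (_, _); apply: scalerDl. Qed.

HB.instance Definition _ :=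
  GRing.Zmodule_isLmodule.Build (R1 * R2)%type (prodmod M1 M2)
    prodmod_scaleA prodmod_scale1 prodmod_scaleDr prodmod_scaleDl.

End ProdMod.

Section Graded.
Variable G : groupType.

Definition additive_subgroup (V : zmodType) (A : set V) : Prop :=
  [/\ A 0, forall x y, A x -> A y -> A (x + y) & forall x, A x -> A (- x)].

(* A is the internal direct sum of the additive subgroups C h, h in G.  The
   uniqueness of the decomposition is stated for 0. *)
Definition direct_sum (V : zmodType) (C : G -> set V) (A : set V) : Prop :=
  [/\ forall h, additive_subgroup (C h) /\ C h `<=` A,
      forall x, A x -> exists (s : seq G) (c : G -> V),
        [/\ uniq s, forall h, C h (c h) & x = \sum_(h <- s) c h] &
      forall (s : seq G) (c : G -> V), uniq s -> (forall h, C h (c h)) ->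
        \sum_(h <- s) c h = 0 -> forall h, h \in s -> c h = 0].

Definition graded_ring (R : comPzRingType) (gR : G -> set R) : Prop :=
  direct_sum gR [set: R] /\
  forall (g h : G) (r s : R), gR g r -> gR h s -> gR (g * h)%g (r * s).

Definition graded_module (R : comPzRingType) (gR : G -> set R)
    (M : lmodType R) (gM : G -> set M) : Prop :=
  direct_sum gM [set: M] /\
  forall (g h : G) (r : R) (m : M), gR g r -> gM h m -> gM (g * h)%g (r *: m).

(* L is an A-submodule of X, for a subring A of R and an A-submodule X of the
   R-module M. *)
Definition is_submodule (R : comPzRingType) (A : set R) (M : lmodType R)
    (X L : set M) : Prop :=
  [/\ L `<=` X, additive_subgroup L &
      forall (r : R) (m : M), A r -> L m -> L (r *: m)].

Definition hcomp (R : comPzRingType) (M : lmodType R) (gM : G -> set M)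
  (N : set M) (h : G) : set M := N `&` gM h.

Definition graded_submodule (R : comPzRingType) (M : lmodType R)
    (gM : G -> set M) (N : set M) : Prop :=
  is_submodule [set: R] [set: M] N /\ direct_sum (hcomp gM N) N.

Definition graded_ideal (R : comPzRingType) (gR : G -> set R)
  (I : set R) : Prop := @graded_submodule R R^o gR I.

Definition gr_noetherian (R : comPzRingType) (gR : G -> set R) : Prop :=
  forall I : nat -> set R,
    (forall n, graded_ideal gR (I n)) -> (forall n, I n `<=` I n.+1) ->
    exists n, forall m, (n <= m)%N -> I m = I n.

Definition add_span (V : zmodType) (S : set V) : set V :=
  [set x | exists2 s : seq V, (forall y, y \in s -> S y) & x = \sum_(y <- s) y].

Definition ideal_mul (R : comPzRingType) (I J : set R) : set R :=
  add_span [set a * b | a in I & b in J].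

Definition ideal_smul (R : comPzRingType) (M : lmodType R) (I : set R)
  (X : set M) : set M := add_span [set a *: x | a in I & x in X].

Definition colon (R : comPzRingType) (A : set R) (M : lmodType R)
  (L X : set M) : set R := [set r | A r /\ forall x, X x -> L (r *: x)].

Section Absorbing.
Variables (R : comPzRingType) (gR : G -> set R).
Variables (M : lmodType R) (gM : G -> set M) (g : G).

Local Notation Re := (gR 1%g).
Local Notation Mg := (gM g).

Definition g_idempotent (L : set M) : Prop :=
  let I := colon Re L Mg in L = ideal_smul (ideal_mul I I) Mg.

Definition fully_g_idempotent : Prop :=
  forall L : set M, is_submodule Re Mg L -> g_idempotent L.

Definition g_G2_absorbing (L : set M) : Prop :=
  [/\ is_submodule Re Mg L, L <> Mg &
      forall (r s : R) (m : M), Re r -> Re s -> Mg m -> L ((r * s) *: m) ->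
        [\/ exists2 k, (0 < k)%N & L (r ^+ k *: m),
            exists2 k, (0 < k)%N & L (s ^+ k *: m) |
            colon Re L Mg (r * s)]].

Definition g_primary (L : set M) : Prop :=
  [/\ is_submodule Re Mg L, L <> Mg &
      forall (r : R) (m : M), Re r -> Mg m -> L (r *: m) ->
        L m \/ exists2 n, (0 < n)%N & colon Re L Mg (r ^+ n)].

End Absorbing.

Definition prod_gring (R1 R2 : comPzRingType) (gR1 : G -> set R1)
  (gR2 : G -> set R2) : G -> set (R1 * R2)%type := fun h => gR1 h `*` gR2 h.

Definition prod_set (R1 R2 : comPzRingType) (M1 : lmodType R1)
  (M2 : lmodType R2) (N1 : set M1) (N2 : set M2) : set (prodmod M1 M2) :=
  N1 `*` N2.

Definition prod_gmod (R1 R2 : comPzRingType) (M1 : lmodType R1)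
    (M2 : lmodType R2) (gM1 : G -> set M1) (gM2 : G -> set M2) :
    G -> set (prodmod M1 M2) :=
  fun h => prod_set (gM1 h) (gM2 h).

End Graded.

(* Main.v *)
Require Import Defs.
From mathcomp Require Import all_boot all_algebra.
From mathcomp Require Import boolp classical_sets.

(** If N_{1,g} and N_{2,g} are both proper, testing the absorbing condition on
    (r,1), (1,0) and (m,x) with x outside N_{2,g} shows that N_{1,g} is even
    prime, and symmetrically for N_{2,g}.  Conversely, full idempotence gives
    r M_g = r^2 M_g for every r in R_e: with I = (r M_g : M_g) one has
    r M_g = I (I M_g), which is contained in I r M_g = r I M_g, hence in
    r^2 M_g.  So r^n M_g <= L already forces r M_g <= L, and a product rs that
    is split between two primary components (r_1^n kills M_{1,g}/N_{1,g},
    s_2^n kills M_{2,g}/N_{2,g}) lies in the residual of N_g. *)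

Set Implicit Arguments.
Unset Strict Implicit.
Unset Printing Implicit Defensive.

Import GRing.Theory.

Local Open Scope classical_set_scope.
Local Open Scope ring_scope.

(** * Sums and homogeneous decompositions *)

Lemma additive_subgroup_sum (V : zmodType) (A : set V) (I : eqType)
    (s : seq I) (F : I -> V) :
  additive_subgroup A -> (forall i, i \in s -> A (F i)) -> A (\sum_(i <- s) F i).
Proof.
case=> A0 AD _ AF; rewrite big_seq.
by apply: (big_ind A) => // x y; apply: AD.
Qed.

Section Graded.
Variable G : groupType.

(** Padding the support with a zero term makes the component of a prescribed degree available by
    name, even when it vanishes. *)
Lemma direct_sum_decomp {V : zmodType} {C : G -> set V} {A : set V} (h0 : G) x :
  direct_sum C A -> A x -> exists (s : seq G) (c : G -> V),
    [/\ uniq s, h0 \in s, forall h, C h (c h) & x = \sum_(h <- s) c h].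
Proof.
case=> subC decA _ /decA [s [c [us Cc ->]]].
have [h0s|h0Ns] := boolP (h0 \in s); first by exists s, c.
exists (h0 :: s), (fun h => if h \in s then c h else 0); split => //=.
- by rewrite h0Ns.
- by rewrite mem_head.
- by move=> h; case: ifP => // _; have [[]] := subC h.
- rewrite big_cons (negbTE h0Ns) add0r.
  by rewrite big_seq [RHS]big_seq; apply: eq_bigr => h ->.
Qed.

(** * Identity degree of a graded ring and its action on homogeneous components *)

Section Ring.
Variables (R : comPzRingType) (gR : G -> set R).
Hypothesis gradedR : graded_ring gR.

Let subgR h : additive_subgroup (gR h).
Proof. by have [[+ _ _] _] := gradedR; case/(_ h). Qed.

Lemma graded_ring0 h : gR h 0.
Proof. by have [] := subgR h. Qed.

(* The degree-1 component c of 1 fixes every homogeneous element, by uniqueness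
   of decompositions, hence every element, so that c = 1. *)
Lemma graded_ring1 : gR 1%g 1.
Proof.
have [dsR mulR] := gradedR; have [_ _ uniqR] := dsR.
have [s [c [us s1 cR one]]] := direct_sum_decomp 1%g dsR (I : setT (1 : R)).
suff fixc h x : gR h x -> x * c 1%g = x.
  have -> : 1 = c 1%g :> R; last exact: cR.
  rewrite -[RHS]mul1r {2}one mulr_suml.
  by rewrite {1}one; apply: eq_bigr => h _; rewrite (fixc h).
move=> xh.
(* Since [x] has degree [h], the degree-[k] part of [x * 1] is [x * c (h^-1 * k)]. So [d k] is the
   degree-[k] part of [x * 1 - x = 0], supported on the translate of [s] by [h]; at [k = h] it is
   [x * c 1 - x]. *)
pose d k := x * c (h^-1 * k)%g - (if k == h then x else 0).
have dR k : gR k (d k).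
  have [_ gD gN] := subgR k; apply: gD; last first.
    by apply: gN; case: eqP => [->//|_]; apply: graded_ring0.
  by rewrite -{1}[k](mulVKg h); apply: mulR.
have dsum : \sum_(k <- [seq (h * i)%g | i <- s]) d k = 0.
  rewrite big_map sumrB.
  under eq_bigr do rewrite mulKg.
  rewrite -mulr_sumr -one mulr1 (bigD1_seq 1%g) //= mulg1 eqxx big1 ?addr0 ?subrr //.
  by move=> i i1; rewrite -{2}[h]mulg1 (inj_eq (mulgI h)) (negbTE i1).
have us' : uniq [seq (h * i)%g | i <- s] by rewrite map_inj_uniq //; apply: mulgI.
have := uniqR _ _ us' dR dsum h.
rewrite /d mulVg eqxx => /(_ _)/subr0_eq; apply.
by apply/mapP; exists 1%g; rewrite ?mulg1.
Qed.

Lemma graded_ringM1 r s : gR 1%g r -> gR 1%g s -> gR 1%g (r * s).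
Proof. by have [_ mulR] := gradedR => /mulR /[apply]; rewrite mulg1. Qed.

Section Module.
Variables (M : lmodType R) (gM : G -> set M).
Hypothesis gradedM : graded_module gR gM.

Lemma graded_module_subgroup g : additive_subgroup (gM g).
Proof. by have [[+ _ _] _] := gradedM; case/(_ g). Qed.

Lemma graded_module_scale g r m : gR 1%g r -> gM g m -> gM g (r *: m).
Proof. by have [_ actM] := gradedM => /actM /[apply]; rewrite mul1g. Qed.

Lemma graded_module_submodule g : is_submodule (gR 1%g) (gM g) (gM g).
Proof.
by split=> //; [apply: graded_module_subgroup | apply: graded_module_scale].
Qed.

Lemma hcomp_submodule N g :
  graded_submodule gM N -> is_submodule (gR 1%g) (gM g) (hcomp gM N g).
Proof.
move=> [[_ [N0 ND NN] NZ] _]; have [M0 MD MN] := graded_module_subgroup g.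
split; first by move=> x [].
  split=> //; first by move=> x y [? ?] [? ?]; split; [apply: ND|apply: MD].
  by move=> x [? ?]; split; [apply: NN|apply: MN].
by move=> r m rR [? ?]; split; [apply: NZ|apply: graded_module_scale].
Qed.

End Module.

End Ring.

(** * Full idempotence and primary submodules in one degree *)

Section Submodule.
Variables (R : comPzRingType) (gR : G -> set R) (M : lmodType R).
Variables (gM : G -> set M) (g : G).

Lemma scale_additive_subgroup (X : set M) (r : R) :
  additive_subgroup X -> additive_subgroup [set r *: x | x in X].
Proof.
case=> X0 XD XN; split; first by exists 0; rewrite ?scaler0.
  by move=> _ _ [x Xx <-] [y Xy <-]; exists (x + y); rewrite ?scalerDr //; apply: XD.
by move=> _ [x Xx <-]; exists (- x); rewrite ?scalerN //; apply: XN.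
Qed.

Lemma submodule_expr (A : set R) (X L : set M) r k m :
  is_submodule A X L -> A r -> L m -> L (r ^+ k *: m).
Proof.
by move=> [_ _ LZ] rA Lm; elim: k => [|k IH]; rewrite ?scale1r // exprS -scalerA; apply: LZ.
Qed.

Lemma fully_idempotent_scale r :
  is_submodule (gR 1%g) (gM g) (gM g) -> fully_g_idempotent gR gM g ->
  gR 1%g r -> forall x, gM g x -> exists2 z, gM g z & r *: x = r ^+ 2 *: z.
Proof.
move=> [_ subM actM] idem rR x Mx.
pose L := [set r *: y | y in gM g].
have subL : is_submodule (gR 1%g) (gM g) L.
  split; [by move=> _ [y My <-]; apply: actM| exact: scale_additive_subgroup|].
  move=> s _ sR [y My <-]; exists (s *: y); first exact: actM.
  by rewrite !scalerA mulrC.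
have : L (r *: x) by exists x.
rewrite [in X in X -> _](idem L subL) => -[s sP ->].
suff [z Mz <-] : [set r ^+ 2 *: z | z in gM g] (\sum_(y <- s) y) by exists z.
apply: additive_subgroup_sum; first exact: scale_additive_subgroup.
move=> _ /sP [_ [t tP ->] [y My <-]]; rewrite scaler_suml.
apply: additive_subgroup_sum; first exact: scale_additive_subgroup.
move=> _ /tP [a [aR aL] [b [bR bL] <-]].
(* Both [a] and [b] send the degree-[g] component into its multiples by [r]: [b y = r u] and
   [a u = r v], so [a b y = r (a u) = r^2 v]. *)
have [u Mu bu] := bL y My; have [v Mv av] := aL u Mu; exists v => //.
by rewrite -[RHS]scalerA -bu [RHS]scalerA mulrC -[RHS]scalerA -av [RHS]scalerA.
Qed.

(** The primary condition is applied twice, to [r] and [s *: m], then to [s] and [m]. *)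
Lemma primary_mul (L : set M) r s m :
  is_submodule (gR 1%g) (gM g) (gM g) -> g_primary gR gM g L ->
  gR 1%g r -> gR 1%g s -> gM g m -> L ((r * s) *: m) ->
  [\/ L m, exists2 n, (0 < n)%N & colon (gR 1%g) L (gM g) (r ^+ n) |
      exists2 n, (0 < n)%N & colon (gR 1%g) L (gM g) (s ^+ n)].
Proof.
move=> [_ _ actM] [_ _ primL] rR sR Mm; rewrite -scalerA.
move=> /(primL _ _ rR (actM _ _ sR Mm)) [|]; last by constructor 2.
by move=> /(primL _ _ sR Mm) [|]; [constructor 1|constructor 3].
Qed.

End Submodule.

(** * Submodules and residuals of a product *)

Section Product.
Variables (R1 R2 : comPzRingType) (gR1 : G -> set R1) (gR2 : G -> set R2).
Variables (M1 : lmodType R1) (M2 : lmodType R2).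
Variables (gM1 : G -> set M1) (gM2 : G -> set M2) (g : G).
Hypotheses (gradedR1 : graded_ring gR1) (gradedR2 : graded_ring gR2).
Hypotheses (gradedM1 : graded_module gR1 gM1).
Hypotheses (gradedM2 : graded_module gR2 gM2).

Local Notation gR := (prod_gring gR1 gR2).
Local Notation gM := (prod_gmod gM1 gM2).

Lemma prodmod_scaleE (r : R1 * R2) (m : prodmod M1 M2) :
  r *: m = (r.1 *: m.1, r.2 *: m.2).
Proof. by []. Qed.

Lemma exprE_pair (r : R1 * R2) k : r ^+ k = (r.1 ^+ k, r.2 ^+ k).
Proof. by elim: k => // k IH; rewrite !exprS IH. Qed.

Lemma hcomp_prod (N1 : set M1) (N2 : set M2) :
  hcomp gM (prod_set N1 N2) g = prod_set (hcomp gM1 N1 g) (hcomp gM2 N2 g).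
Proof. by apply/seteqP; split=> [[x y] [[? ?] [? ?]]|[x y] [[? ?] [? ?]]]. Qed.

Lemma prod_submodule (A1 : set R1) (A2 : set R2) (X1 L1 : set M1)
    (X2 L2 : set M2) :
  is_submodule A1 X1 L1 -> is_submodule A2 X2 L2 ->
  is_submodule (A1 `*` A2) (prod_set X1 X2) (prod_set L1 L2).
Proof.
move=> [LX1 [L10 L1D L1N] L1Z] [LX2 [L20 L2D L2N] L2Z]; split.
- by move=> x [/LX1 ? /LX2 ?].
- split=> //; first by move=> x y [? ?] [? ?]; split; [apply: L1D|apply: L2D].
  by move=> x [? ?]; split; [apply: L1N|apply: L2N].
- by move=> r m [? ?] [? ?]; split; [apply: L1Z|apply: L2Z].
Qed.

Lemma colon_prod (L1 : set M1) (L2 : set M2) (r : R1 * R2) :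
  colon (gR1 1%g) L1 (gM1 g) r.1 -> colon (gR2 1%g) L2 (gM2 g) r.2 ->
  colon (gR 1%g) (prod_set L1 L2) (gM g) r.
Proof.
by move=> [? h1] [? h2]; split=> // x [? ?]; split; [apply: h1|apply: h2].
Qed.

Lemma colon_fst (L1 : set M1) (L2 : set M2) (r : R1 * R2) :
  colon (gR 1%g) (prod_set L1 L2) (gM g) r -> colon (gR1 1%g) L1 (gM1 g) r.1.
Proof.
move=> [[? ?] h]; split=> // x Mx.
have [M20 _ _] := graded_module_subgroup gradedM2 g.
by have [] := h (x, 0) (conj Mx M20).
Qed.

Lemma colon_snd (L1 : set M1) (L2 : set M2) (r : R1 * R2) :
  colon (gR 1%g) (prod_set L1 L2) (gM g) r -> colon (gR2 1%g) L2 (gM2 g) r.2.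
Proof.
move=> [[? ?] h]; split=> // x Mx.
have [M10 _ _] := graded_module_subgroup gradedM1 g.
by have [] := h (0, x) (conj M10 Mx).
Qed.

Lemma prod_submodule_full :
  is_submodule (gR 1%g) (gM g) (gM g).
Proof. by apply: prod_submodule; apply: graded_module_submodule. Qed.

(** * Absorbing products with proper or full factors *)

Variables (L1 : set M1) (L2 : set M2).
Hypotheses (subL1 : is_submodule (gR1 1%g) (gM1 g) L1).
Hypotheses (subL2 : is_submodule (gR2 1%g) (gM2 g) L2).

Let L : set (prodmod M1 M2) := prod_set L1 L2.

Let exists_notin (V : Type) (A B : set V) : A `<=` B -> A <> B ->
  exists2 x, B x & ~ A x.
Proof.
move=> AB neq; apply: contrapT => h; apply: neq; apply/seteqP; split=> // x Bx.
by apply: contrapT => Ax; apply: h; exists x.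
Qed.

Lemma G2_absorbing_prod_primary1 :
  g_G2_absorbing gR gM g L -> L1 <> gM1 g -> L2 <> gM2 g ->
  g_primary gR1 gM1 g L1.
Proof.
move=> [_ _ absL] L1M L2M; split=> // r m rR Mm Lrm.
have [LM2 [L20 _ _] _] := subL2.
have [x Mx Lx] := exists_notin LM2 L2M.
(* The product [(r, 0)] sends [(m, x)] to [(r m, 0)], which lies in [L]. Powers of [(r, 1)] fix [x],
   which is outside [L2]; powers of [(1, 0)] fix [m], giving [m] in [L1]; the residual alternative
   gives exponent 1. *)
have [||//||[k _]|[k _]|] := absL (r, 1) (1, 0) (m, x).
- by split=> //; apply: graded_ring1.
- by split; [apply: graded_ring1|apply: graded_ring0].
- by split; rewrite /= ?mulr1 ?mulr0 ?scale0r.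
- by rewrite exprE_pair => -[_] /=; rewrite expr1n scale1r.
- by rewrite exprE_pair => -[] /=; rewrite expr1n scale1r; left.
- by move=> /colon_fst /=; rewrite mulr1; right; exists 1%N.
Qed.

Lemma G2_absorbing_prod_primary2 :
  g_G2_absorbing gR gM g L -> L1 <> gM1 g -> L2 <> gM2 g ->
  g_primary gR2 gM2 g L2.
Proof.
move=> [_ _ absL] L1M L2M; split=> // r m rR Mm Lrm.
have [LM1 [L10 _ _] _] := subL1.
have [x Mx Lx] := exists_notin LM1 L1M.
have [||//||[k _]|[k _]|] := absL (1, r) (0, 1) (x, m).
- by split=> //; apply: graded_ring1.
- by split; [apply: graded_ring0|apply: graded_ring1].
- by split; rewrite /= ?mulr1 ?mulr0 ?scale0r.
- by rewrite exprE_pair => -[] /=; rewrite expr1n scale1r.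
- by rewrite exprE_pair => -[_] /=; rewrite expr1n scale1r; left.
- by move=> /colon_snd /=; rewrite mulr1; right; exists 1%N.
Qed.

(** With a full first factor, every membership condition on the first coordinate holds
    automatically, so only the second one is tested. *)
Lemma G2_absorbing_prod_full1 : L1 = gM1 g ->
  g_G2_absorbing gR gM g L <-> g_G2_absorbing gR2 gM2 g L2.
Proof.
move=> L1M; have [M10 _ _] := graded_module_subgroup gradedM1 g.
have act1 := graded_module_scale gradedM1.
split=> [[_ LM absL]|[_ LM absL]]; split=> //.
- by move=> L2M; apply: LM; rewrite /L L1M L2M.
- move=> r s m rR sR Mm Lrsm; have R11 := graded_ring1 gradedR1.
  (* The first coordinates only serve to lift [r], [s], [m] to homogeneous elements of the
     product. *)
  have [//|//|//||[k k0]|[k k0]|] := absL (1, r) (1, s) (0, m).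
  + by split; rewrite /= ?scaler0 ?L1M.
  + by rewrite exprE_pair => -[_ ?]; constructor 1; exists k.
  + by rewrite exprE_pair => -[_ ?]; constructor 2; exists k.
  + by move=> /colon_snd; constructor 3.
- exact: prod_submodule.
- move=> eqL; apply: LM; apply/seteqP; split; first by case: subL2.
  move=> x Mx; have : gM g (0, x) by [].
  by rewrite -eqL => -[].
- move=> r s m [r1 r2] [s1 s2] [m1 m2] [_ Lrsm].
  have [[k k0 Lk]|[k k0 Lk]|rsL] := absL _ _ _ r2 s2 m2 Lrsm.
  + constructor 1; exists k; rewrite // exprE_pair; split=> //=.
    by apply: (submodule_expr _ subL1); rewrite ?L1M.
  + constructor 2; exists k; rewrite // exprE_pair; split=> //=.
    by apply: (submodule_expr _ subL1); rewrite ?L1M.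
  + constructor 3; apply: colon_prod => //; rewrite L1M; split.
      exact: graded_ringM1.
    by move=> x; apply: act1; apply: graded_ringM1.
Qed.

Lemma G2_absorbing_prod_full2 : L2 = gM2 g ->
  g_G2_absorbing gR gM g L <-> g_G2_absorbing gR1 gM1 g L1.
Proof.
move=> L2M; have [M20 _ _] := graded_module_subgroup gradedM2 g.
have act2 := graded_module_scale gradedM2.
split=> [[_ LM absL]|[_ LM absL]]; split=> //.
- by move=> L1M; apply: LM; rewrite /L L1M L2M.
- move=> r s m rR sR Mm Lrsm; have R21 := graded_ring1 gradedR2.
  have [//|//|//||[k k0]|[k k0]|] := absL (r, 1) (s, 1) (m, 0).
  + by split; rewrite /= ?scaler0 ?L2M.
  + by rewrite exprE_pair => -[? _]; constructor 1; exists k.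
  + by rewrite exprE_pair => -[? _]; constructor 2; exists k.
  + by move=> /colon_fst; constructor 3.
- exact: prod_submodule.
- move=> eqL; apply: LM; apply/seteqP; split; first by case: subL1.
  move=> x Mx; have : gM g (x, 0) by [].
  by rewrite -eqL => -[].
- move=> r s m [r1 r2] [s1 s2] [m1 m2] [Lrsm _].
  have [[k k0 Lk]|[k k0 Lk]|rsL] := absL _ _ _ r1 s1 m1 Lrsm.
  + constructor 1; exists k; rewrite // exprE_pair; split=> //=.
    by apply: (submodule_expr _ subL2); rewrite ?L2M.
  + constructor 2; exists k; rewrite // exprE_pair; split=> //=.
    by apply: (submodule_expr _ subL2); rewrite ?L2M.
  + constructor 3; apply: colon_prod => //; rewrite L2M; split.
      exact: graded_ringM1.
    by move=> x; apply: act2; apply: graded_ringM1.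
Qed.

(** * Full idempotence of the product and primary factors *)

Hypothesis idemM : fully_g_idempotent gR gM g.

(** Each step replaces [r z] by [r^2 y] inside [r^(n+1) z = r^n (r z)], raising the exponent by
    one. *)
Lemma fully_idempotent_scaleX (r : R1 * R2) n x :
  gR 1%g r -> gM g x -> exists2 z, gM g z & r *: x = r ^+ n.+1 *: z.
Proof.
move=> rR Mx; elim: n => [|n [z Mz ->]]; first by exists x.
have [y My zy] := fully_idempotent_scale prod_submodule_full idemM rR Mz.
by exists y; rewrite // exprSr -scalerA zy scalerA -exprD addn2.
Qed.

Lemma colon_expr1 r n : gR1 1%g r -> (0 < n)%N ->
  colon (gR1 1%g) L1 (gM1 g) (r ^+ n) -> colon (gR1 1%g) L1 (gM1 g) r.
Proof.
case: n => // n rR _ [_ rnL]; split=> // x Mx.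
have [M20 _ _] := graded_module_subgroup gradedM2 g.
(* Idempotence is assumed on the product only, so [r] and [x] are padded with zeros and the first
   coordinate is read off. *)
have [z [Mz _]] := @fully_idempotent_scaleX (r, 0) n (x, 0)
  (conj rR (graded_ring0 gradedR2 _)) (conj Mx M20).
by rewrite exprE_pair => -[-> _]; apply: rnL.
Qed.

Lemma colon_expr2 r n : gR2 1%g r -> (0 < n)%N ->
  colon (gR2 1%g) L2 (gM2 g) (r ^+ n) -> colon (gR2 1%g) L2 (gM2 g) r.
Proof.
case: n => // n rR _ [_ rnL]; split=> // x Mx.
have [M10 _ _] := graded_module_subgroup gradedM1 g.
have [z [_ Mz]] := @fully_idempotent_scaleX (0, r) n (0, x)
  (conj (graded_ring0 gradedR1 _) rR) (conj M10 Mx).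
by rewrite exprE_pair => -[_ ->]; apply: rnL.
Qed.

Lemma primary_prod_G2_absorbing :
  g_primary gR1 gM1 g L1 -> g_primary gR2 gM2 g L2 ->
  g_G2_absorbing gR gM g L.
Proof.
move=> prim1 prim2; have [M20 _ _] := graded_module_subgroup gradedM2 g.
split; first exact: prod_submodule.
  have [_ L1M _] := prim1; move=> eqL; apply: L1M.
  apply/seteqP; split; first by case: subL1.
  by move=> x Mx; have : gM g (x, 0) by []; rewrite -eqL => -[].
have colonM (S : comPzRingType) (gS : G -> set S) (V : lmodType S)
    (gV : G -> set V) (K : set V) (a b : S) : graded_ring gS ->
    graded_module gS gV -> gS 1%g b ->
    colon (gS 1%g) K (gV g) a -> colon (gS 1%g) K (gV g) (a * b).
  move=> gdS gdV Sb [Sa Ka]; split; first exact: graded_ringM1.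
  by move=> x Vx; rewrite -scalerA; apply: Ka; exact: (graded_module_scale gdV).
have full1 := graded_module_submodule gradedM1 g.
have full2 := graded_module_submodule gradedM2 g.
move=> r s m [r1 r2] [s1 s2] [Mm1 Mm2] [/= Lrs1 Lrs2].
have powL (q : R1 * R2) : L1 (q.1 *: m.1) -> L2 (q.2 *: m.2) ->
  exists2 k, (0 < k)%N & L (q ^+ k *: m) by exists 1%N.
have [_ _ act1] := subL1; have [_ _ act2] := subL2.
have := primary_mul full1 prim1 r1 s1 Mm1 Lrs1.
have := primary_mul full2 prim2 r2 s2 Mm2 Lrs2.
(* In seven of the nine cases a single one of [r], [s] sends both coordinates of [m] into [L], and
   exponent 1 suffices. In the other two, [r] lies in one residual and [s] in the other, so [r * s]
   lies in both. *)
move=> [Lm2|[n n0 /(colon_expr2 r2 n0) c2]|[n n0 /(colon_expr2 s2 n0) c2]];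
move=> [Lm1|[p p0 /(colon_expr1 r1 p0) c1]|[p p0 /(colon_expr1 s1 p0) c1]].
- by constructor 1; apply: powL; [apply: act1|apply: act2].
- by constructor 1; apply: powL; [apply: c1.2|apply: act2].
- by constructor 2; apply: powL; [apply: c1.2|apply: act2].
- by constructor 1; apply: powL; [apply: act1|apply: c2.2].
- by constructor 1; apply: powL; [apply: c1.2|apply: c2.2].
- constructor 3; apply: colon_prod; last exact: colonM.
  by rewrite /= mulrC; apply: colonM.
- by constructor 2; apply: powL; [apply: act1|apply: c2.2].
- constructor 3; apply: colon_prod; first exact: colonM.
  by rewrite /= mulrC; apply: colonM.
- by constructor 2; apply: powL; [apply: c1.2|apply: c2.2].
Qed.

End Product.

End Graded.

(** * The equivalence, by cases on which components are full *)

Theorem theorem3p9 (G : groupType) (g : G)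
  (R1 R2 : comPzRingType) (gR1 : G -> set R1) (gR2 : G -> set R2)
  (M1 : lmodType R1) (M2 : lmodType R2)
  (gM1 : G -> set M1) (gM2 : G -> set M2)
  (N1 : set M1) (N2 : set M2)
  (G_abelian : forall x y : G, commute x y)
  (gradedR1 : graded_ring gR1) (gradedR2 : graded_ring gR2)
  (noethR1 : gr_noetherian gR1) (noethR2 : gr_noetherian gR2)
  (gradedM1 : graded_module gR1 gM1) (gradedM2 : graded_module gR2 gM2)
  (gradedN1 : graded_submodule gM1 N1) (gradedN2 : graded_submodule gM2 N2)
  (idemM : fully_g_idempotent (prod_gring gR1 gR2) (prod_gmod gM1 gM2) g) :
  g_G2_absorbing (prod_gring gR1 gR2) (prod_gmod gM1 gM2) g
    (hcomp (prod_gmod gM1 gM2) (prod_set N1 N2) g)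
  <->
  [\/ hcomp gM1 N1 g = gM1 g /\ g_G2_absorbing gR2 gM2 g (hcomp gM2 N2 g),
      hcomp gM2 N2 g = gM2 g /\ g_G2_absorbing gR1 gM1 g (hcomp gM1 N1 g) |
      g_primary gR1 gM1 g (hcomp gM1 N1 g) /\
      g_primary gR2 gM2 g (hcomp gM2 N2 g)].

Proof.
have subN1 := hcomp_submodule gradedM1 g gradedN1.
have subN2 := hcomp_submodule gradedM2 g gradedN2.
have full1 := G2_absorbing_prod_full1 gradedR1 gradedM1 subN1 subN2.
have full2 := G2_absorbing_prod_full2 gradedR2 gradedM2 subN1 subN2.
rewrite hcomp_prod; split; last first.
  case=> [[/full1 abs2]|[/full2 abs1]|[prim1 prim2]].
  - by move/abs2.
  - by move/abs1.
  - exact: primary_prod_G2_absorbing.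
move=> absN.
have [N1M|N1M] := pselect (hcomp gM1 N1 g = gM1 g).
  by constructor 1; split=> //; apply/(full1 N1M).
have [N2M|N2M] := pselect (hcomp gM2 N2 g = gM2 g).
  by constructor 2; split=> //; apply/(full2 N2M).
constructor 3; split.
  exact: G2_absorbing_prod_primary1 absN N1M N2M.
exact: G2_absorbing_prod_primary2 absN N1M N2M.
Qed.
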